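(* Let $p$ be a prime, let $r,n$ be positive integers, let $Q$ be a quadratic form over the free $\mathbb{Z}/(p^r)$-module $(\mathbb{Z}/(p^r))^n$ with associated bilinear form $b(\vec x,\vec y)=Q(\vec x+\vec y)-Q(\vec x)-Q(\vec y)$, and let $f\in\operatorname{Aut}((\mathbb{Z}/(p^r))^n)$ satisfy $Q(f(\vec v))=Q(\vec v)$ for all $\vec v$ and have order $p^{r'}$ for some $0\le r'\le r$. Let $A=(\mathbb{Z}/(p^r))^{n+1}$ be the additive abelian group with elements written $(\vec x,\mu)$, $\vec x\in(\mathbb{Z}/(p^r))^n$, $\mu\in\mathbb{Z}/(p^r)$. Put $q(\vec x,\mu)=\mu-Q(\vec x)$ and $$\lambda_{(\vec{x},\mu)}(\vec{y},\mu')=\bigl(f^{q(\vec{x},\mu)}(\vec{y}),\ \mu'+b(\vec{x},f^{q(\vec{x},\mu)}(\vec{y}))\bigr)$$ for $(\vec x,\mu),(\vec y,\mu')\in A$. Then the abelian group $A$ has a structure of a left brace with lambda map $\lambda$ and with multiplication given by $a\cdot a'=a+\lambda_a(a')$. Moreover, if $Q$ is non-degenerate, then the socle of this left brace is $$\operatorname{Soc}(A)=\{(\vec 0,\mu)\mid \mu\in p^{r'}\mathbb{Z}/(p^r)\}.$$ In particular, if $r'=r$ (and $Q$ is non-degenerate), then the socle of this left brace is zero.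
   Context: A left brace is a set $B$ with operations $+,\cdot$ such that $(B,+)$ is an abelian group, $(B,\cdot)$ is a group and $a\cdot(b+c)+a=a\cdot b+a\cdot c$ for all $a,b,c\in B$. Its lambda map is $\lambda\colon(B,\cdot)\to\operatorname{Aut}(B,+)$, $\lambda_a(b)=ab-a$. The socle is $\operatorname{Soc}(B)=\{b\in B\mid\lambda_b=\operatorname{id}\}$. The powers $f^{q(\vec x,\mu)}$ are well defined since $q(\vec x,\mu)\in\mathbb{Z}/(p^r)$ and the order of $f$ divides $p^r$. The quadratic form $Q$ is non-degenerate if the matrix of $b$ in the standard basis of $(\mathbb{Z}/(p^r))^n$ is invertible over $\mathbb{Z}/(p^r)$. $p^{r'}\mathbb{Z}/(p^r)$ denotes the ideal of $\mathbb{Z}/(p^r)$ generated by $p^{r'}$. *)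

(* Defs.v *)
From HB Require Import structures.
From mathcomp Require Import all_boot all_order all_algebra all_fingroup.

Set Implicit Arguments.
Unset Strict Implicit.
Unset Printing Implicit Defensive.

Import GRing.Theory.
Local Open Scope ring_scope.

(* A left brace structure on a given abelian group (B, +). *)
Record left_brace (B : zmodType) := LeftBrace {
  bmul : B -> B -> B;
  bone : B;
  binv : B -> B;
  bmulA : associative bmul;
  bmul1b : left_id bone bmul;
  bmulb1 : right_id bone bmul;
  bmulVb : left_inverse bone binv bmul;
  bmulbV : right_inverse bone binv bmul;
  bmul_addr : forall a b c, bmul a (b + c) + a = bmul a b + bmul a c
}.

Section LeftBrace.
Variables (B : zmodType) (S : left_brace B).

Definition blambda (a b : B) : B := bmul S a b - a.

Definition socle (b : B) : Prop := forall c, blambda b c = c.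

(* The next three lemmas say that [blambda] is a group morphism from (B, .)
   to Aut(B, +). *)
Lemma blambdaD a b c : blambda a (b + c) = blambda a b + blambda a c.
Proof.
have := bmul_addr S a b c; rewrite /blambda => /(canRL (addrK a)) ->.
by rewrite -addrA addrACA.
Qed.

Lemma blambdaM a b c : blambda (bmul S a b) c = blambda a (blambda b c).
Proof.
have := bmul_addr S a (blambda b c) b; rewrite /blambda subrK bmulA.
by move=> e; apply/eqP; rewrite subr_eq addrAC eq_sym subr_eq e.
Qed.

Lemma blambda_bij a : bijective (blambda a).
Proof.
have l1 c : blambda (bone S) c = c.
  have e : bone S = 0.
    by have := bmul_addr S (bone S) 0 0; rewrite !bmul1b !addr0 add0r.
  by rewrite /blambda bmul1b e subr0.
by exists (blambda (binv S a)) => c; rewrite -blambdaM ?bmulVb ?bmulbV l1.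
Qed.

End LeftBrace.

Definition polar (R : comNzRingType) (M : lmodType R) (Q : M -> R) (x y : M) : R :=
  Q (x + y) - Q x - Q y.

Definition quadratic_form (R : comNzRingType) (M : lmodType R) (Q : M -> R) : Prop :=
  [/\ forall (a : R) (x : M), Q (a *: x) = a ^+ 2 * Q x,
      forall y, scalar (polar Q ^~ y)
    & forall x, scalar (polar Q x)].

Definition nondegenerate_quadratic_form (R : comUnitRingType) (n : nat) (Q : 'rV[R]_n -> R) : Prop :=
  (\matrix_(i < n, j < n) polar Q (delta_mx 0 i) (delta_mx 0 j)) \in unitmx.

Section LambdaMap.
Variables (m n : nat) (Q : 'rV['Z_m]_n -> 'Z_m) (f : {perm 'rV['Z_m]_n}).

Definition qval (a : 'rV['Z_m]_n * 'Z_m) : 'Z_m := a.2 - Q a.1.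

(* [qval a : nat] is the canonical representative of a residue mod m; when the
   order of f divides m, f ^+ (qval a) does not depend on the representative. *)
Definition fpow (a : 'rV['Z_m]_n * 'Z_m) : {perm 'rV['Z_m]_n} :=
  (f ^+ (qval a : nat))%g.

Definition lambda_map (a b : 'rV['Z_m]_n * 'Z_m) : 'rV['Z_m]_n * 'Z_m :=
  (fpow a b.1, b.2 + polar Q a.1 (fpow a b.1)).

End LambdaMap.

(* Main.v *)
Require Import Defs.
From HB Require Import structures.
From mathcomp Require Import all_boot all_order all_algebra all_fingroup.
From mathcomp Require Import cyclic.

(** A left brace on an abelian group [B] is the same thing as a map
    [lam : B -> B -> B], additive in its second argument and with every
    [lam a] invertible, that satisfies the cocycle identity
    [lam (a + lam a b) = lam a \o lam b]: the product is then
    [a + lam a b], its associativity is the cocycle identity, and the brace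
    axiom is additivity ([lambda_brace]).

    For the map at hand the cocycle identity rests on a single computation:
    [q (x, mu) = mu - Q x] is additive for the new product, that is,
    [q (a + lam a b) = q a + q b] ([qval_bmul]).  Indeed the second coordinate
    of [lam a b] contributes the correction term [b(x, f^(q a) y)], which is
    exactly the cross term in [Q (x + f^(q a) y)], while
    [Q (f^(q a) y) = Q y] since [f] is an isometry.  Hence the powers of [f]
    multiply as they should; the second coordinates agree by bilinearity of the
    polar form and its invariance under [f] ([lambda_map_bmul]).

    An element [(x, mu)] is in the socle iff [f^(q (x, mu)) = 1] and [x] is
    orthogonal to everything.  If [Q] is non-degenerate the second condition
    forces [x = 0]; the first then says that [f^mu = 1], that is, that the order
    [p^r'] of [f] divides [mu]. *)

Set Implicit Arguments.
Unset Strict Implicit.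
Unset Printing Implicit Defensive.

Import GRing.Theory.
Local Open Scope ring_scope.

(** * Left braces from lambda maps *)

Section LambdaBrace.
Variables (B : zmodType) (lam : B -> B -> B) (inv : B -> B).
Hypothesis lamD : forall a, {morph lam a : b c / b + c}.
Hypothesis lam0 : forall b, lam 0 b = b.
Hypothesis lamM : forall a b c, lam (a + lam a b) c = lam a (lam b c).
Hypothesis lamV : forall a, lam a (inv a) = - a.

Let mul a b := a + lam a b.

Lemma lambda_mulA : associative mul.
Proof. by move=> a b c; rewrite /mul lamD lamM addrA. Qed.

Lemma lambda_mul0b : left_id 0 mul.
Proof. by move=> b; rewrite /mul lam0 add0r. Qed.

Lemma lambda_mulb0 : right_id 0 mul.
Proof.
move=> a; rewrite /mul; suff -> : lam a 0 = 0 by rewrite addr0.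
by apply: (addrI (lam a 0)); rewrite -lamD !addr0.
Qed.

Lemma lambda_mulbV : right_inverse 0 inv mul.
Proof. by move=> a; rewrite /mul lamV subrr. Qed.

(** In a monoid in which every element has a right inverse, right inverses are
    two-sided. *)
Lemma lambda_mulVb : left_inverse 0 inv mul.
Proof.
move=> a; have e : a = inv (inv a).
  by rewrite -[LHS]lambda_mulb0 -(lambda_mulbV (inv a)) lambda_mulA lambda_mulbV
             lambda_mul0b.
by rewrite [X in mul _ X]e lambda_mulbV.
Qed.

Lemma lambda_mul_addr a b c : mul a (b + c) + a = mul a b + mul a c.
Proof. by rewrite /mul lamD -addrA [_ + a]addrC addrACA -!addrA addrCA. Qed.

Definition lambda_brace : left_brace B :=
  LeftBrace lambda_mulA lambda_mul0b lambda_mulb0 lambda_mulVb lambda_mulbV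
            lambda_mul_addr.

Lemma blambda_lambda_brace a b : blambda lambda_brace a b = lam a b.
Proof. by rewrite /blambda /= /mul addrC addrA addNr add0r. Qed.

End LambdaBrace.

(** * Quadratic forms and their polar forms *)

Section QuadraticForm.
Variables (R : comNzRingType) (M : lmodType R) (Q : M -> R).
Hypothesis Q_quad : quadratic_form Q.

Lemma quadratic_form0 : Q 0 = 0.
Proof. by case: Q_quad => QZ _ _; rewrite -(scale0r 0) QZ expr0n mul0r. Qed.

Lemma polarDl x y z : polar Q (x + y) z = polar Q x z + polar Q y z.
Proof. by case: Q_quad => _ bl _; have := bl z 1 x y; rewrite scale1r mul1r. Qed.

Lemma polarDr x y z : polar Q x (y + z) = polar Q x y + polar Q x z.
Proof. by case: Q_quad => _ _ br; have := br x 1 y z; rewrite scale1r mul1r. Qed.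

Lemma polar0l x : polar Q 0 x = 0.
Proof. by rewrite /polar quadratic_form0 add0r subr0 subrr. Qed.

Lemma polar0r x : polar Q x 0 = 0.
Proof. by rewrite /polar quadratic_form0 addr0 subr0 subrr. Qed.

Lemma polarZl a x y : polar Q (a *: x) y = a * polar Q x y.
Proof.
case: Q_quad => _ bl _; have := bl y a x 0.
by rewrite /= !addr0 polar0l addr0.
Qed.

Lemma polarNr x y : polar Q x (- y) = - polar Q x y.
Proof. by apply/eqP; rewrite -addr_eq0 -polarDr addNr polar0r. Qed.

Lemma quadratic_formD x y : Q (x + y) = Q x + Q y + polar Q x y.
Proof. by rewrite /polar -[X in _ = _ + X]addrA -opprD [RHS]addrC subrK. Qed.

Lemma polar_isom (g : M -> M) x y :
  {morph g : u v / u + v} -> (forall v, Q (g v) = Q v) ->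
  polar Q (g x) (g y) = polar Q x y.
Proof. by move=> gD gQ; rewrite /polar -gD !gQ. Qed.

End QuadraticForm.

Lemma nondegenerate_orthogonal (R : comUnitRingType) (n : nat)
    (Q : 'rV[R]_n -> R) (x : 'rV[R]_n) :
  quadratic_form Q -> nondegenerate_quadratic_form Q ->
  (forall y, polar Q x y = 0) -> x = 0.
Proof.
move=> Qq; rewrite /nondegenerate_quadratic_form; set G := \matrix_(i, j) _ => Gu ox.
suff xG0 : x *m G = 0 by rewrite -(mulmxK Gu x) xG0 mul0mx.
apply/rowP=> j; rewrite !mxE -[RHS](ox (delta_mx 0 j)) [in RHS](row_sum_delta x).
rewrite (big_morph (polar Q ^~ (delta_mx 0 j)) (fun u v => polarDl Qq u v _)
                   (polar0l Qq _)).
by apply: eq_bigr => i _; rewrite mxE polarZl.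
Qed.

(** * The lambda map of an isometry *)

Section IsometryBrace.
Variables (m n : nat) (Q : 'rV['Z_m]_n -> 'Z_m) (f : {perm 'rV['Z_m]_n}).
Hypothesis m_gt1 : (1 < m)%N.
Hypothesis Q_quad : quadratic_form Q.
Hypothesis fD : {morph f : u v / u + v}.
Hypothesis f_isom : forall v, Q (f v) = Q v.
Hypothesis f_order : (#[f]%g %| m)%N.

Local Notation A := ('rV['Z_m]_n * 'Z_m)%type.

(** The exponents [0 .. m-1] add modulo [m], so this needs [f ^+ m = 1]. *)
Lemma expg_ZpD (i j : 'Z_m) : (f ^+ (i + j)%R = f ^+ i * f ^+ j)%g.
Proof.
have fm : (f ^+ (Zp_trunc m).+2 = 1)%g.
  by apply/eqP; rewrite -order_dvdn (dvdn_trans f_order) // Zp_cast.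
by rewrite /= expg_mod // expgD.
Qed.

Lemma fpowD (a : A) : {morph fpow Q f a : u v / u + v}.
Proof.
rewrite /fpow => u v; elim: (nat_of_ord _) => [|k IHk]; first by rewrite !perm1.
by rewrite expgSr !permM IHk fD.
Qed.

Lemma fpow_isom (a : A) v : Q (fpow Q f a v) = Q v.
Proof.
rewrite /fpow; elim: (nat_of_ord _) => [|k IHk]; first by rewrite perm1.
by rewrite expgSr permM f_isom.
Qed.

Lemma polar_fpow (a : A) u v :
  polar Q (fpow Q f a u) (fpow Q f a v) = polar Q u v.
Proof. exact: polar_isom (@fpowD a) (@fpow_isom a). Qed.

(** The term added to the second coordinate by [lambda_map] is exactly the cross
    term of [Q] on the sum of the first coordinates. *)
Lemma qval_bmul (a b : A) : qval Q (a + lambda_map Q f a b) = qval Q a + qval Q b.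
Proof.
rewrite /qval /= quadratic_formD fpow_isom.
by rewrite addrA opprD addrACA subrr addr0 opprD addrACA.
Qed.

Lemma fpow_bmul (a b : A) v :
  fpow Q f (a + lambda_map Q f a b) v = fpow Q f a (fpow Q f b v).
Proof. by rewrite /fpow qval_bmul addrC expg_ZpD permM. Qed.

Lemma lambda_mapD (a : A) : {morph lambda_map Q f a : b c / b + c}.
Proof.
by move=> b c; rewrite /lambda_map /= fpowD polarDr //; congr (_, _); rewrite addrACA.
Qed.

Lemma fpow_qval0 (a : A) v : qval Q a = 0 -> fpow Q f a v = v.
Proof. by rewrite /fpow => ->; rewrite perm1. Qed.

Lemma qval0l mu : qval Q (0, mu) = mu.
Proof. by rewrite /qval quadratic_form0 // subr0. Qed.

Lemma lambda_map0 (b : A) : lambda_map Q f 0 b = b.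
Proof.
rewrite /lambda_map polar0l // addr0 fpow_qval0 -?surjective_pairing //.
exact: qval0l.
Qed.

Lemma lambda_map_bmul (a b c : A) :
  lambda_map Q f (a + lambda_map Q f a b) c
    = lambda_map Q f a (lambda_map Q f b c).
Proof.
have := fpow_bmul a b c.1; set ab := a + _ => f_ab.
have ab1 : ab.1 = a.1 + fpow Q f a b.1 by [].
rewrite /lambda_map f_ab ab1 polarDl // polar_fpow /=.
by rewrite addrA addrAC.
Qed.

(** Solves [a + lambda_map Q f a b = 0] for [b]: the first coordinate is
    [f^(- q a)] applied to [- x], and then [b(x, f^(q a) b.1) = - b(x, x)] has to
    be compensated in the second one. *)
Definition isometry_binv (a : A) : A :=
  ((fpow Q f a)^-1%g (- a.1), - a.2 + polar Q a.1 a.1).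

Lemma lambda_map_binv (a : A) : lambda_map Q f a (isometry_binv a) = - a.
Proof. by rewrite /lambda_map /= permKV polarNr // addrK. Qed.

Definition isometry_brace : left_brace A :=
  lambda_brace lambda_mapD lambda_map0 lambda_map_bmul lambda_map_binv.

Lemma blambda_isometry_brace a b :
  blambda isometry_brace a b = lambda_map Q f a b.
Proof. exact: blambda_lambda_brace. Qed.

Lemma socle_isometry_brace x mu :
  nondegenerate_quadratic_form Q ->
  socle isometry_brace (x, mu) <-> x = 0 /\ (#[f]%g %| mu)%N.
Proof.
move=> Qn; split=> [sx | [-> f_mu] [y nu]].
  have fix_f y : fpow Q f (x, mu) y = y.
    by have /(congr1 fst) := sx (y, 0); rewrite blambda_isometry_brace.
  have x0 : x = 0.
    apply: nondegenerate_orthogonal Q_quad Qn _ => y.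
    have /(congr1 snd) := sx (y, 0); rewrite blambda_isometry_brace /=.
    by rewrite add0r fix_f.
  split=> //; rewrite order_dvdn; apply/eqP/permP=> y; rewrite perm1.
  by have := fix_f y; rewrite x0 /fpow qval0l.
rewrite blambda_isometry_brace /lambda_map polar0l // addr0 /fpow qval0l.
by move: f_mu; rewrite order_dvdn => /eqP ->; rewrite perm1.
Qed.

End IsometryBrace.

(** * The socle over the integers modulo a prime power *)

(** When [d] divides [m], divisibility by [d] of the representative in [0 .. m-1]
    depends only on the residue class, so it is membership in the ideal
    generated by [d]. *)
Lemma dvdn_Zp_ideal (m d : nat) (mu : 'Z_m) :
  (1 < m)%N -> (d %| m)%N -> (d %| mu)%N <-> exists c : 'Z_m, mu = c * d%:R.
Proof.
move=> m_gt1 d_m; split=> [/dvdnP[k mu_k] | [c ->]].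
  by exists k%:R; rewrite -natrM -mu_k natr_Zp.
by rewrite -[c]natr_Zp -natrM val_Zp_nat // /dvdn modn_dvdm // modnMl.
Qed.

Theorem theorem3p1 (p r n r' : nat)
    (Q : 'rV['Z_(p ^ r)]_n -> 'Z_(p ^ r))
    (f : {perm 'rV['Z_(p ^ r)]_n})
    (p_prime : prime p) (r_gt0 : (0 < r)%N) (n_gt0 : (0 < n)%N)
    (Q_quad : quadratic_form Q)
    (f_lin : linear f)
    (f_isom : forall v, Q (f v) = Q v)
    (r'_le_r : (r' <= r)%N)
    (f_order : #[f]%g = (p ^ r')%N) :
  exists A : left_brace ('rV['Z_(p ^ r)]_n * 'Z_(p ^ r))%type,
    [/\ forall a b, blambda A a b = lambda_map Q f a b,
        forall a b, bmul A a b = a + lambda_map Q f a b,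
        nondegenerate_quadratic_form Q ->
          forall x mu, socle A (x, mu) <->
            x = 0 /\ exists c : 'Z_(p ^ r), mu = c * (p ^ r')%:R
      & nondegenerate_quadratic_form Q -> r' = r -> forall a, socle A a <-> a = 0].
Proof.
have m_gt1 : (1 < p ^ r)%N by rewrite -(exp1n r) ltn_exp2r ?prime_gt1.
have d_m : (p ^ r' %| p ^ r)%N by rewrite dvdn_exp2l.
have fD : {morph f : u v / u + v}.
  by move=> u v; have := f_lin 1 u v; rewrite !scale1r.
have f_m : (#[f]%g %| p ^ r)%N by rewrite f_order.
pose A := isometry_brace m_gt1 Q_quad fD f_isom f_m.
have socA : nondegenerate_quadratic_form Q -> forall x mu,
    socle A (x, mu) <-> x = 0 /\ exists c : 'Z_(p ^ r), mu = c * (p ^ r')%:R.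
  move=> Qn x mu.
  have := socle_isometry_brace m_gt1 Q_quad fD f_isom f_m x mu Qn.
  have := dvdn_Zp_ideal mu m_gt1 d_m; rewrite f_order -/A.
  by move=> dvd_mu socA; split=> [/socA[-> /dvd_mu] | [x0 /dvd_mu mu_d]] //; apply/socA.
exists A; split=> //; first exact: blambda_isometry_brace.
move=> Qn r'r [x mu]; split=> [/(socA Qn)[-> [c ->]] | [-> ->]].
  by rewrite r'r pchar_Zp // mulr0.
by apply/(socA Qn); split=> //; exists 0; rewrite mul0r.
Qed.
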